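(* Let $r_0,r_1,\dots,r_n>0$. Then there exists a unique system of points $0=w_0<w_1<\dots<w_n<2\pi$ such that \[\Big\|\prod_{j=0}^n\Big|\sin\frac{t-w_j}{2}\Big|^{r_j}\Big\|=\inf_{0=y_0\le y_1\le\dots\le y_n\le2\pi}\Big\|\prod_{j=0}^n\Big|\sin\frac{t-y_j}{2}\Big|^{r_j}\Big\|,\] where $\|\cdot\|$ is the sup-norm over $t\in[0,2\pi]$. The extremal generalized trigonometric polynomial $T^*(t)=\prod_{j=0}^n|\sin\frac{t-w_j}{2}|^{r_j}$ is uniquely determined by the property that there exist $0<z_0<z_1<\dots<z_n<2\pi$ interlacing with the $w_j$'s, i.e. $0=w_0<z_0<w_1<z_1<\dots<w_n<z_n<2\pi$, such that $T^*(z_j)=\|T^*\|$ for $j=0,1,\dots,n$. *)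

(* Defs.v *)
From HB Require Import structures.
From mathcomp Require Import all_boot all_order all_algebra.
From mathcomp Require Import all_classical all_reals all_analysis.
Set Implicit Arguments. Unset Strict Implicit. Unset Printing Implicit Defensive.
Import Order.TTheory GRing.Theory Num.Theory.
Local Open Scope classical_set_scope.
Local Open Scope ring_scope.

Definition gtp (R : realType) (n : nat) (r w : 'I_n.+1 -> R) (t : R) : R :=
  \prod_(j < n.+1) (`|sin ((t - w j) / 2)| `^ r j).

Definition supnorm (R : realType) (f : R -> R) : R :=
  sup [set `|f t| | t in `[0, 2 * pi]%classic].

Definition strict_nodes (R : realType) (n : nat) (w : 'I_n.+1 -> R) : Prop :=
  w ord0 = 0 /\ (forall i j : 'I_n.+1, (i < j)%N -> w i < w j)
  /\ w ord_max < 2 * pi.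

Definition weak_nodes (R : realType) (n : nat) (y : 'I_n.+1 -> R) : Prop :=
  y ord0 = 0 /\ (forall i j : 'I_n.+1, (i <= j)%N -> y i <= y j)
  /\ y ord_max <= 2 * pi.

Definition min_norm (R : realType) (n : nat) (r : 'I_n.+1 -> R) : R :=
  inf [set supnorm (gtp r y) | y in weak_nodes (n := n)].

Definition interlace (R : realType) (n : nat) (w z : 'I_n.+1 -> R) : Prop :=
  (forall i j : 'I_n.+1, (i <= j)%N -> w i < z j)
  /\ (forall i j : 'I_n.+1, (j < i)%N -> z j < w i)
  /\ (forall j : 'I_n.+1, z j < 2 * pi).

(* Main.v *)
Require Import Defs.
From mathcomp Require Import all_boot all_order all_algebra.
From mathcomp Require Import all_classical all_reals all_analysis.
From mathcomp Require Import ring lra.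
Import Order.TTheory GRing.Theory Num.Theory.
Import numFieldNormedType.Exports.
Local Open Scope ring_scope.

(** Write [F_y t] for the logarithm of the generalized polynomial with nodes [y].

    A minimizer of the norm exists by compactness.  If some arc between two
    nodes (possibly degenerate) did not meet the norm, moving its left end [a]
    to the left and its right end [b] to the right, by amounts inversely
    proportional to [r a] and [r b], would by concavity of [ln (sin x)] decrease
    [F_y] strictly at every point outside the arc, hence decrease the norm.  So
    a minimizer has distinct nodes and meets its norm on each arc.

    Conversely let [y] be such a minimizer, with maximum points [z], and let [w]
    equioscillate at [zeta].  The tangent inequality for [ln |sin x|] gives
    [F_w (zeta j) - F_y (z j) <=
       - \sum_k r k * cot ((z j - y k) / 2) * (w k - y k) / 2],
    where the terms in [zeta j - z j] cancel because [z j] is stationary.  There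
    are weights [l j > 0] with [\sum_j l j * cot ((z j - y k) / 2) = 0] for all
    [k], so the weighted sum over [j] of the left-hand sides is nonpositive.  As
    each of them is nonnegative, all tangent inequalities are equalities, which
    forces [w = y]. *)

(** * Concavity of the logarithm of the sine *)

Section LogSine.
Set Implicit Arguments. Unset Strict Implicit.
Variable R : realType.
Implicit Types a b x y t : R.

Definition cot x : R := cos x / sin x.

(* [ln (sin x ^+ 2) / 2] is [ln `|sin x|], written so that it is differentiable
   without a case distinction on the sign. *)
Definition logsin x : R := ln (sin x ^+ 2) / 2.

Lemma cotN x : cot (- x) = - cot x.
Proof. by rewrite /cot sinN cosN invrN mulrN. Qed.

Lemma logsinN x : logsin (- x) = logsin x.
Proof. by rewrite /logsin sinN sqrrN. Qed.

Lemma powR_sinE x (r : R) : sin x != 0 -> `|sin x| `^ r = expR (r * logsin x).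
Proof.
move=> s0; rewrite /powR normr_eq0 (negbTE s0); congr (expR (_ * _)).
rewrite /logsin -real_normK ?num_real// lnXn ?normr_gt0//.
lra.
Qed.

Lemma is_derive_logsin x : sin x != 0 -> is_derive x 1 logsin (cot x).
Proof.
move=> s0.
have s2 : 0 < sin x ^+ 2 by rewrite exprn_even_gt0.
have h1 := @is_derive1_ln R _ s2.
have h2 : is_derive x 1 (fun x => sin x ^+ 2) (2 * sin x * cos x).
  rewrite (_ : (fun x => _) = sin * sin); last by apply/funext => z.
  apply: is_derive_eq; rewrite /GRing.scale /=; ring.
have h3 : is_derive x 1 ((@ln R) \o (fun x => sin x ^+ 2)) ((sin x ^+ 2)^-1 * (2 * sin x * cos x)).
  exact: is_derive1_comp.
rewrite (_ : logsin = (2^-1) \*: ((@ln R) \o (fun x => sin x ^+ 2))); last first.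
  by apply/funext => z; rewrite /logsin /= mulrC.
apply: is_derive_eq; rewrite /cot /GRing.scale /=; field; exact: s0.
Qed.

Lemma cot_decr x y : 0 < x -> x < y -> y < pi -> cot y < cot x.
Proof.
move=> x0 xy yp.
have sx : 0 < sin x by apply: sin_gt0_pi; lra.
have sy : 0 < sin y by apply: sin_gt0_pi; lra.
have : 0 < sin (y - x) by apply: sin_gt0_pi; lra.
rewrite sinB /cot ltr_pdivrMr// mulrAC ltr_pdivlMr//; lra.
Qed.

(** By the mean value theorem the chord has slope [cot c] with [c] strictly between [a] and [b], and
    [cot] is strictly decreasing there. *)
Lemma logsin_tangent_pos a b : 0 < a < pi -> 0 < b < pi -> a != b ->
  logsin b < logsin a + cot a * (b - a).
Proof.
move=> /andP[a0 ap] /andP[b0 bp] ab.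
have key u v : 0 < u -> u < v -> v < pi ->
    exists2 c, u < c < v & logsin v - logsin u = cot c * (v - u).
  move=> u0 uv vp.
  have d x : x \in `[u, v] -> is_derive x 1 logsin (cot x).
    rewrite in_itv/= => /andP[ux xv]; apply: is_derive_logsin.
    by rewrite gt_eqF// sin_gt0_pi//; lra.
  have d' x : x \in `]u, v[ -> is_derive x 1 logsin (cot x).
    by rewrite in_itv/= => /andP[/ltW ux /ltW xv]; apply: d; rewrite in_itv/= ux.
  have cont : {within `[u, v], continuous logsin}%classic.
    apply: continuous_in_subspaceT => y; rewrite inE/= => /d dy.
    by apply/differentiable_continuous/derivable1_diffP; exact: ex_derive.
  have [c cuv E] := MVT uv d' cont.
  by exists c; rewrite // in_itv in cuv.
case: (ltgtP a b) ab => // [ab|ba] _.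
  have [c /andP[ac cb] E] := key _ _ a0 ab bp.
  have := @cot_decr a c a0 ac (lt_trans cb bp); nra.
have [c /andP[ac cb] E] := key _ _ b0 ba ap.
have := @cot_decr c a (lt_trans b0 ac) cb ap; nra.
Qed.

Lemma logsin_tangent a b :
  (0 < a < pi /\ 0 < b < pi) \/ (- pi < a < 0 /\ - pi < b < 0) -> a != b ->
  logsin b < logsin a + cot a * (b - a).
Proof.
case=> [[ha hb]|[ha hb] ab]; first exact: logsin_tangent_pos.
have /= := @logsin_tangent_pos (- a) (- b).
rewrite !logsinN cotN eqr_opp => /(_ _ _ ab).
rewrite (_ : - cot a * (- b - - a) = cot a * (b - a)); last by ring.
by apply; lra.
Qed.

(** In the sum of the tangent inequalities at [x] and [y] the first-order terms combine to
    [r * p * (cot x - cot y)], which is nonpositive because [y <= x]. *)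
Lemma logsin_spread (r s p q x y : R) : 0 < r -> 0 < s -> 0 < p -> r * p = s * q ->
  0 < y - q -> y <= x -> x + p < pi ->
  r * logsin (x + p) + s * logsin (y - q) < r * logsin x + s * logsin y.
Proof.
move=> r0 s0 p0 E yq yx xp.
have q0 : 0 < q by rewrite -(pmulr_rgt0 _ s0) -E mulr_gt0.
have := @logsin_tangent_pos x (x + p); have := @logsin_tangent_pos y (y - q).
rewrite !(addrC _ p) !(addrC _ (- q)) !addrK => h1 h2.
have {}h1 : logsin (- q + y) < logsin y + cot y * - q by apply: h1; lra.
have {}h2 : logsin (p + x) < logsin x + cot x * p by apply: h2; lra.
have cxy : cot x <= cot y.
  by move: yx; rewrite le_eqVlt => /predU1P[->//|yx]; apply/ltW/cot_decr; lra.
have {}h1 : s * logsin (- q + y) < s * (logsin y + cot y * - q) by rewrite ltr_pM2l.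
have {}h2 : r * logsin (p + x) < r * (logsin x + cot x * p) by rewrite ltr_pM2l.
have : cot x * (r * p) <= cot y * (s * q) by rewrite E ler_wpM2r// mulr_ge0// ltW.
lra.
Qed.

End LogSine.

(** * Positive weights from interlacing points *)

Section PartialFractions.
Set Implicit Arguments. Unset Strict Implicit.
Variable F : realFieldType.
Variable n : nat.
Variables (c : 'I_n.+1 -> F) (b : 'I_n -> F).
Hypothesis c_decr : forall i j : 'I_n.+1, (i < j)%N -> c j < c i.
Hypothesis bc : forall (j : 'I_n.+1) (k : 'I_n), (j <= k)%N -> b k < c j.
Hypothesis cb : forall (j : 'I_n.+1) (k : 'I_n), (k < j)%N -> c j < b k.

(* The weights are the coefficients of the partial fraction decomposition of
   [\prod_k (X - b k) / \prod_j (X - c j)], which interlacing makes positive. *)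
Lemma interlacing_weights :
  exists mu : 'I_n.+1 -> F, (forall j, 0 < mu j) /\
    forall k, \sum_j mu j / (b k - c j) = 0.
Proof.
(* This is [P.[c j] / (L j).[c j]] for the polynomials [P] and [L j] introduced below. *)
pose mu j := \prod_(k < n) ((c j - b k) / (c j - c (lift j k))).
have c_inj : injective c.
  move=> i j E; apply/eqP; case: (ltngtP i j) => [/c_decr|/c_decr|/val_inj -> //];
  by rewrite E ltxx.
have clift j k : c j - c (lift j k) != 0 by rewrite subr_eq0 (inj_eq c_inj) neq_lift.
exists mu; split.
  move=> j; apply: prodr_gt0 => k _.
  (* [lift j k] is [k] if [k < j] and [k + 1] otherwise, so numerator and denominator are both
     negative in the first case and both positive in the second. *)
  have [kj|jk] := ltnP k j.
    rewrite -(mulrNN _ _^-1) -invrN divr_gt0// oppr_gt0 subr_lt0; first exact: cb.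
    by apply: c_decr; rewrite /= /bump (leqNgt j k) kj.
  rewrite divr_gt0// subr_gt0; first exact: bc.
  by apply: c_decr; rewrite /= /bump jk.
move=> k.
pose P := \prod_(k < n) ('X - (b k)%:P).
pose L (j : 'I_n.+1) := \prod_(k < n) ('X - (c (lift j k))%:P).
pose Q := \sum_j mu j *: L j.
have sL (e : 'I_n -> F) : size (\prod_(k < n) ('X - (e k)%:P)) = n.+1.
  by rewrite size_prod_XsubC -[RHS]/(n.+1) /index_enum -enumT size_enum_ord.
have L0 i j : i != j -> (L j).[c i] = 0.
  rewrite /L horner_prod => ij; case: (unliftP j i) ij => [m ->|->]; last by rewrite eqxx.
  by rewrite (bigD1 m)//= hornerXsubC subrr mul0r.
(* Lagrange interpolation: [P] and [Q] have size at most [n.+1] and agree at the [n.+1] distinct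
   points [c i]. *)
have PQ : P - Q = 0.
  apply: (@roots_geq_poly_eq0 _ _ [seq c i | i <- enum 'I_n.+1]).
  - apply/allP => _ /mapP[i _ ->]; rewrite rootE hornerD hornerN subr_eq0.
    rewrite horner_sum (bigD1 i)//= [X in _ + X]big1 ?addr0; last first.
      by move=> j ji; rewrite hornerZ L0 ?mulr0 // eq_sym.
    rewrite hornerZ !horner_prod /mu prodf_div mulrC.
    have -> : \prod_(k0 < n) ('X - (c (lift i k0))%:P).[c i] = \prod_(k0 < n) (c i - c (lift i k0)).
      by apply: eq_bigr => m _; rewrite hornerXsubC.
    rewrite mulrC divfK; last by apply/prodf_neq0 => m _.
    by apply/eqP/eq_bigr => m _; rewrite hornerXsubC.
  - by rewrite map_inj_uniq ?enum_uniq.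
  - rewrite size_map size_enum_ord (leq_trans (size_polyD _ _))// size_polyN geq_max sL leqnn/=.
    rewrite (leq_trans (size_sum _ _ _))//; apply/bigmax_leqP => j _.
    by rewrite (leq_trans (size_scale_leq _ _))// sL.
have bc0 j : b k - c j != 0.
  rewrite subr_eq0; have [/cb|/bc] := ltnP k j => h; first by rewrite gt_eqF.
  by rewrite lt_eqF.
(* Clearing denominators turns the sum into [Q.[b k]], and [b k] is a root of [P]. *)
have : (\prod_j (b k - c j)) * (\sum_j mu j / (b k - c j)) = 0.
  transitivity Q.[b k]; last first.
    move/eqP: PQ; rewrite subr_eq0 => /eqP <-.
    by rewrite horner_prod (bigD1 k)//= hornerXsubC subrr mul0r.
  rewrite horner_sum mulr_sumr; apply: eq_bigr => j _.
  rewrite hornerZ horner_prod (bigD1_ord j)//= mulrCA; congr (_ * _).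
  rewrite mulrAC divff// mul1r; apply: eq_bigr => m _; by rewrite hornerXsubC.
by move/eqP; rewrite mulf_eq0 => /orP[/prodf_eq0[j _]|/eqP//]; rewrite (negbTE (bc0 j)).
Qed.

End PartialFractions.

(** * Stationarity and rigidity of interlacing systems *)

Section Rigidity.
Set Implicit Arguments. Unset Strict Implicit.
Variables (R : realType) (n : nat).
Implicit Types (r y w z : 'I_n.+1 -> R) (t : R).

Lemma sin_neq0 (x : R) : 0 < x < pi \/ - pi < x < 0 -> sin x != 0.
Proof.
case=> h; first by rewrite gt_eqF// sin_gt0_pi.
by rewrite -oppr_eq0 -sinN gt_eqF// sin_gt0_pi//; lra.
Qed.

(** For fixed [x] this exhibits [cot (x - w)] as a constant plus a simple pole in [cot w], the shape
    of the terms in [interlacing_weights]. *)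
Lemma cotB (x w : R) : sin x != 0 -> sin w != 0 -> sin (x - w) != 0 ->
  cot (x - w) = cot x + (sin x ^+ 2 * (cot w - cot x))^-1.
Proof.
move=> x0 w0 xw0.
have E : cot w - cot x = sin (x - w) / (sin x * sin w).
  by rewrite /cot sinB; field; rewrite x0 w0.
have Ew : sin w = sin x * cos (x - w) - cos x * sin (x - w).
  by rewrite -sinB; congr sin; ring.
rewrite E /cot; move: Ew w0 xw0; set s := sin (x - w); set d := cos (x - w) => Ew w0 s0.
apply: (mulIf (mulf_neq0 x0 s0)).
rewrite mulrDl [LHS](_ : _ = sin x * d); last by field.
rewrite (_ : (_)^-1 * _ = sin w); last by field; rewrite w0 x0.
by rewrite Ew; field.
Qed.

Lemma gtpE r y t : (forall k, sin ((t - y k) / 2) != 0) ->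
  gtp r y t = expR (\sum_k r k * logsin ((t - y k) / 2)).
Proof.
by move=> s0; rewrite expR_sum; apply: eq_bigr => k _; rewrite powR_sinE.
Qed.

Lemma stationary_at_max r y (z0 : R) : (forall k, sin ((z0 - y k) / 2) != 0) ->
  (forall t, gtp r y t <= gtp r y z0) ->
  \sum_k r k * cot ((z0 - y k) / 2) = 0.
Proof.
move=> s0 zmax.
(* On a whole neighborhood of [z0] all factors are nonzero, so there the polynomial is the
   exponential of the differentiable sum [G]. *)
have near_neq0 k : \forall t \near z0, sin ((t - y k) / 2) != 0.
  have : {for z0, continuous (fun t => sin ((t - y k) / 2))}.
    apply: continuous_comp; last exact: continuous_sin.
    by apply: cvgM; [apply: cvgB; [exact: cvg_id|exact: cvg_cst]|exact: cvg_cst].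
  by move=> /cvgr_neq0; exact.
have := filter_forall (nbhs_filter z0) near_neq0.
case/nbhs_ballP => e /= e0 he.
have {}he t : t \in `]z0 - e, z0 + e[ -> forall k, sin ((t - y k) / 2) != 0.
  rewrite in_itv/= => ht; apply: he; rewrite /ball/= distrC ltr_norml; lra.
pose G (t : R) := \sum_k r k * logsin ((t - y k) / 2).
have dG t : t \in `]z0 - e, z0 + e[ ->
    is_derive t 1 G (\sum_k r k * (cot ((t - y k) / 2) / 2)).
  move=> /he ht; rewrite /G (_ : (fun t => _) =
     \sum_k (fun t => r k * logsin ((t - y k) / 2))); last first.
    by apply/funext => u; rewrite fct_sumE.
  apply: is_derive_sum => k.
  have h1 := is_derive_logsin (ht k).
  have h2 : is_derive t 1 (fun t => (t - y k) / 2) (2^-1).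
    rewrite (_ : (fun t => _) = 2^-1 \*: (id - cst (y k))); last first.
      by apply/funext => u /=; rewrite mulrC.
    by apply: is_derive_eq; rewrite subr0 /GRing.scale /= mulr1.
  have h3 := @is_derive1_comp _ (@logsin R) (fun t => (t - y k) / 2) t _ _ h1 h2.
  rewrite (_ : (fun t => _) = (r k) \*: ((@logsin R) \o (fun t => (t - y k) / 2))) //.
  by apply: is_derive_eq.
have zin : z0 \in `]z0 - e, z0 + e[ by rewrite in_itv/=; lra.
have d0 : is_derive z0 1 G 0.
  apply: (@derive1_at_max _ G (z0 - e) (z0 + e)) => //; first by lra.
    by move=> t /dG dt; exact: ex_derive.
  move=> t /he ht; rewrite /G -ler_expR -!gtpE//; exact: zmax.
have [_ E0] := d0; have [_ E1] := dG _ zin.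
have : (\sum_k r k * cot ((z0 - y k) / 2)) / 2 = 0.
  rewrite -[RHS]E0 E1 mulr_suml; apply: eq_bigr => k _; by rewrite mulrA.
lra.
Qed.

(** The sign depends on [j] and [k] alone, so for two interlacing systems the corresponding half
    angles lie on the same side of the singularity at 0, as [logsin_tangent] requires. *)
Lemma interlace_half_angle y z (j k : 'I_n.+1) : strict_nodes y -> interlace y z ->
  if (k <= j)%N then 0 < (z j - y k) / 2 < pi else - pi < (z j - y k) / 2 < 0.
Proof.
case=> y0 [yi yn] [yz [zy z2]].
have yk : 0 <= y k < 2 * pi.
  apply/andP; split.
    rewrite -y0; have [->//|k0] := eqVneq k ord0.
    by apply/ltW/yi; rewrite /= lt0n.
  apply: le_lt_trans yn; have [->//|kn] := eqVneq k ord_max.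
  apply/ltW/yi; rewrite /= ltn_neqAle -ltnS ltn_ord andbT.
  by apply: contra kn => /eqP h; apply/eqP/val_inj.
have zj := z2 j; have z0 := yz ord0 j (leq0n _); rewrite y0 in z0.
by have [/yz|/zy] := leqP k j; lra.
Qed.

Lemma interlace_sin_neq0 y z (j k : 'I_n.+1) : strict_nodes y -> interlace y z ->
  sin ((z j - y k) / 2) != 0.
Proof.
move=> sy yz; have := interlace_half_angle j k sy yz.
by case: ifP => _ h; apply: sin_neq0; [left|right].
Qed.

(* The substitution [c = cot (z / 2)], [b = cot (y / 2)] turns
   [cot ((z - y) / 2)] into [(1 + c ^+ 2) / (b - c) + c], which reduces the claim
   to [interlacing_weights] up to a constant independent of [k]; stationarity
   makes that constant vanish. *)
Lemma stationary_weights r y z : (forall j, 0 < r j) ->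
  strict_nodes y -> interlace y z ->
  (forall j, \sum_k r k * cot ((z j - y k) / 2) = 0) ->
  exists l : 'I_n.+1 -> R, (forall j, 0 < l j) /\
    forall k, \sum_j l j * cot ((z j - y k) / 2) = 0.
Proof.
move=> r0 sy iyz st.
have [y0 [yi yn]] := sy; have [yz [zy z2]] := iyz.
have z0 j : 0 < z j by rewrite -y0; exact: yz.
have zi (i j : 'I_n.+1) : (i < j)%N -> z i < z j.
  by move=> ij; apply: lt_trans (yz _ _ (leqnn j)); exact: zy.
pose c j := cot (z j / 2); pose b (k : 'I_n) := cot (y (lift ord0 k) / 2).
have yl (k : 'I_n) : 0 < y (lift ord0 k) < 2 * pi.
  rewrite -y0 yi//=; apply: le_lt_trans yn.
  have [->//|kn] := eqVneq (lift ord0 k) ord_max.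
  apply/ltW/yi; rewrite [X in (_ < X)%N]/= ltn_neqAle -ltnS ltn_ord andbT.
  by apply: contra kn => /eqP h; apply/eqP/val_inj.
have [|||mu [mu0 mub]] := @interlacing_weights R n c b.
- by move=> i j ij; have := zi _ _ ij; have := z0 i; have := z2 j => *; apply: cot_decr; lra.
- move=> j k jk; have := yl k; have := z0 j.
  have := zy (lift ord0 k) j; rewrite lift0 ltnS => /(_ jk) => *.
  by apply: cot_decr; lra.
- move=> j k kj; have := yl k; have := z2 j.
  have := yz (lift ord0 k) j; rewrite lift0 => /(_ kj) => *.
  by apply: cot_decr; lra.
pose l j := mu j * sin (z j / 2) ^+ 2.
have sz j : sin (z j / 2) != 0.
  by apply: sin_neq0; left; have := z0 j; have := z2 j; lra.
(* The square of the sine in [l] cancels the one in [cotB], leaving the pole terms whose sum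
   vanishes by [mub]; for [k = ord0] there is no pole term, since [y ord0 = 0]. *)
have lk k : \sum_j l j * cot ((z j - y k) / 2) = \sum_j l j * c j.
  case: (unliftP ord0 k) => [m ->|->]; last first.
    by apply: eq_bigr => j _; rewrite y0 subr0.
  rewrite -[RHS]addr0 -[X in _ = _ + X](mub m) -big_split/=; apply: eq_bigr => j _.
  have sl : sin (y (lift ord0 m) / 2) != 0.
    by apply: sin_neq0; left; have := yl m; lra.
  have := interlace_sin_neq0 j (lift ord0 m) sy iyz.
  rewrite mulrBl => s0; rewrite cotB// mulrDr; congr (_ + _).
  by rewrite /l invfM mulrA mulfK// expf_neq0.
exists l; split; first by move=> j; rewrite /l mulr_gt0// exprn_even_gt0//= sz.
(* The double sum of [r k * l j * cot ((z j - y k) / 2)] is computed in both orders: by [lk] and by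
   stationarity. *)
have s0 : (\sum_k r k) * (\sum_j l j * c j) = 0.
  rewrite mulr_suml; under eq_bigr => k _ do rewrite -(lk k) mulr_sumr.
  rewrite exchange_big/= big1// => j _.
  under eq_bigr => k _ do rewrite mulrCA.
  by rewrite -mulr_sumr st mulr0.
move=> k; rewrite lk; move/eqP: s0; rewrite mulf_eq0 => /orP[|/eqP//].
have : 0 < \sum_k r k.
  by rewrite (bigD1 ord0)//= ltr_pwDl// sumr_ge0// => i _; exact: ltW.
by move=> /gt_eqF ->.
Qed.

Lemma interlacing_rigidity r y z w zeta : (forall j, 0 < r j) ->
  strict_nodes y -> interlace y z ->
  (forall j, \sum_k r k * cot ((z j - y k) / 2) = 0) ->
  strict_nodes w -> interlace w zeta ->
  (forall j, gtp r y (z j) <= gtp r w (zeta j)) -> w = y.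
Proof.
move=> r0 sy iyz st sw iwz hle.
have [l [l0 lE]] := stationary_weights r0 sy iyz st.
pose a j k := (z j - y k) / 2; pose b j k := (zeta j - w k) / 2.
pose gap j k := r k * (logsin (a j k) + cot (a j k) * (b j k - a j k) - logsin (b j k)).
have tang j k : a j k != b j k ->
    logsin (b j k) < logsin (a j k) + cot (a j k) * (b j k - a j k).
  apply: logsin_tangent; rewrite /a /b.
  have := interlace_half_angle j k sy iyz; have := interlace_half_angle j k sw iwz.
  by case: ifP => _ h1 h2; [left|right].
have gap0 j k : 0 <= gap j k.
  rewrite /gap mulr_ge0 ?(ltW (r0 k))// subr_ge0.
  have [->|/tang/ltW//] := eqVneq (a j k) (b j k); by rewrite subrr mulr0 addr0.
have sumgap : \sum_j l j * \sum_k gap j k <= 0.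
  have E j : \sum_k gap j k <= - \sum_k (r k * cot (a j k) * ((w k - y k) / 2)).
    have := hle j; rewrite !gtpE; try by move=> k; exact: interlace_sin_neq0.
    rewrite ler_expR -subr_le0 -sumrB => h.
    (* The increment [b j k - a j k] splits into a part independent of [k], which stationarity
       removes, and the displacement of the nodes. *)
    have -> : \sum_k gap j k = \sum_k (r k * logsin (a j k) - r k * logsin (b j k))
       + (\sum_k r k * cot (a j k)) * ((zeta j - z j) / 2)
       - \sum_k (r k * cot (a j k) * ((w k - y k) / 2)).
      rewrite mulr_suml -big_split -sumrB; apply: eq_bigr => k _ /=.
      by rewrite /gap /a /b; field.
    have -> : \sum_k r k * cot (a j k) = 0 by exact: st.
    by rewrite mul0r addr0 gerDr.
  have : \sum_j l j * \sum_k gap j k <=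
         \sum_j l j * - \sum_k (r k * cot (a j k) * ((w k - y k) / 2)).
    by apply: ler_sum => j _; rewrite ler_pM2l.
  move=> /le_trans; apply.
  under eq_bigr => j _ do rewrite mulrN mulr_sumr.
  rewrite sumrN exchange_big/= oppr_le0 big1// => k _.
  transitivity ((\sum_j l j * cot (a j k)) * (r k * ((w k - y k) / 2))).
    rewrite mulr_suml; apply: eq_bigr => j _; ring.
  by rewrite lE mul0r.
have ab j k : a j k = b j k.
  apply/eqP; case: eqP => // /eqP /tang ltab; move: sumgap.
  suff : 0 < \sum_j l j * \sum_k gap j k by lra.
  rewrite (bigD1 j)//= ltr_pwDl//; last first.
    by apply: sumr_ge0 => i _; rewrite mulr_ge0 ?sumr_ge0// ltW.
  rewrite mulr_gt0// (bigD1 k)//= ltr_pwDl ?sumr_ge0// mulr_gt0//; lra.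
(* As both systems start at 0, [ab ord0 ord0] gives [z ord0 = zeta ord0], and then [ab ord0 k]
   compares the nodes. *)
apply/funext => k; have := ab ord0 k; have := ab ord0 ord0.
by rewrite /a /b; have [-> _] := sy; have [-> _] := sw; lra.
Qed.

End Rigidity.

(** * Continuity, periodicity and existence of a minimizer *)

Section Minimizer.
Set Implicit Arguments. Unset Strict Implicit.
Local Open Scope classical_set_scope.
Variables (R : realType) (n : nat).
Implicit Types (y w : 'I_n.+1 -> R) (t : R).

Lemma powR_normr_continuous (s : R) : 0 < s -> continuous (fun x : R => `|x| `^ s).
Proof.
move=> s0 x; have [->|x0] := eqVneq x 0.
  rewrite /continuous_at normr0 powR0 ?gt_eqF//; apply/cvgrPdist_lt => e e0.
  have d0 : 0 < e `^ s^-1 by rewrite powR_gt0.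
  near=> t.
  have ht : `|t| < e `^ s^-1.
    by near: t; apply/nbhs_ballP; exists (e `^ s^-1) => //= u; rewrite /ball/= sub0r normrN.
  rewrite sub0r normrN ger0_norm ?powR_ge0//.
  have -> : e = (e `^ s^-1) `^ s by rewrite -powRrM mulVf ?gt_eqF// powRr1// ltW.
  by apply: gt0_ltr_powR; rewrite ?nnegrE ?normr_ge0 ?(ltW d0).
apply: (@continuous_comp _ _ _ (@Num.norm R R) (fun a => a `^ s)).
  exact: norm_continuous.
apply/differentiable_continuous/derivable1_diffP/derivable_powR.
by rewrite in_itv/= andbT normr_gt0.
Unshelve. all: by end_near. Qed.

Lemma cvg_prod_seq (T I : Type) (F : set_system T) (FF : Filter F)
    (f : I -> T -> R) (l : I -> R) (s : seq I) :
  (forall i, f i u @[u --> F] --> l i) ->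
  \prod_(i <- s) f i u @[u --> F] --> \prod_(i <- s) l i.
Proof.
move=> fl; elim: s => [|i s ih].
  by rewrite big_nil; under eq_fun do rewrite big_nil; exact: cvg_cst.
by rewrite big_cons; under eq_fun do rewrite big_cons; exact: cvgM.
Qed.

Variable r : 'I_n.+1 -> R.
Hypothesis r_gt0 : forall j, 0 < r j.

(** Nodes and evaluation point both depend on a parameter, which covers fixed nodes, a fixed point,
    and the joint variation in [arc_meets_supnorm]. *)
Lemma gtp_continuous (T : topologicalType) (Y : T -> 'I_n.+1 -> R) (g : T -> R) (x : T) :
  (forall k, {for x, continuous (fun u => Y u k)}) -> {for x, continuous g} ->
  {for x, continuous (fun u => gtp r (Y u) (g u))}.
Proof.
move=> cY cg; apply: cvg_prod_seq => k.
apply: (@continuous_comp _ _ _ (fun u => sin ((g u - Y u k) / 2)) (fun x => `|x| `^ r k)).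
  apply: continuous_comp; last exact: continuous_sin.
  by apply: cvgM; [apply: cvgB; [exact: cg|exact: cY]|exact: cvg_cst].
exact: powR_normr_continuous.
Qed.

Lemma gtp_ge0 y t : 0 <= gtp r y t.
Proof. by apply: prodr_ge0 => j _; exact: powR_ge0. Qed.

Lemma gtp_le1 y t : gtp r y t <= 1.
Proof.
apply: prodr_ile1 => j _; rewrite powR_ge0/=.
have <- : 1 `^ r j = 1 :> R by rewrite powR1.
by apply: ge0_ler_powR; rewrite ?nnegrE ?normr_ge0 ?sin_max ?(ltW (r_gt0 j)).
Qed.

Lemma gtp_eq0 y k : gtp r y (y k) = 0.
Proof.
by rewrite /gtp (bigD1 k)//= subrr mul0r sin0 normr0 powR0 ?mul0r// gt_eqF.
Qed.

Lemma gtpD2pi y t : gtp r y (t + 2 * pi) = gtp r y t.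
Proof.
apply: eq_bigr => k _.
have -> : (t + 2 * pi - y k) / 2 = (t - y k) / 2 + pi by field.
by rewrite sinDpi normrN.
Qed.

Lemma gtp_reduce y (c t : R) :
  exists2 t', c <= t' < c + 2 * pi & gtp r y t' = gtp r y t.
Proof.
have pi0 := pi_gt0 R.
have per m x : gtp r y (x + 2 * pi *+ m) = gtp r y x.
  by elim: m => [|m ih]; rewrite ?mulr0n ?addr0// mulrSr addrA gtpD2pi.
have perz (m : int) x : gtp r y (x + 2 * pi * m%:~R) = gtp r y x.
  case: m => m; first by rewrite -pmulrn mulr_natr per.
  rewrite NegzE mulrNz mulrN -pmulrn mulr_natr.
  by rewrite -[LHS](per m.+1) subrK.
pose m := Num.floor ((t - c) / (2 * pi)).
exists (t + 2 * pi * (- m)%:~R); last exact: perz.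
have /andP[h1 h2] := floor_itv ((t - c) / (2 * pi)).
move: h1 h2; rewrite ler_pdivlMr ?mulr_gt0// ltr_pdivrMr ?mulr_gt0//.
rewrite -/m intrD mulrNz; lra.
Qed.

Lemma gtp_le_supnorm y t : gtp r y t <= supnorm (gtp r y).
Proof.
have [t' ht <-] := gtp_reduce y 0 t.
apply: ub_le_sup; last first.
  exists t'; last by rewrite ger0_norm// gtp_ge0.
  by rewrite /= in_itv/=; lra.
by exists 1 => _ [u _ <-]; rewrite ger0_norm ?gtp_ge0// gtp_le1.
Qed.

Lemma supnorm_attained y :
  exists2 t, 0 <= t <= 2 * pi & gtp r y t = supnorm (gtp r y).
Proof.
have pi0 := pi_gt0 R.
have [||c c01 cmax] := @EVT_max R (gtp r y) 0 (2 * pi).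
- by rewrite mulr_ge0// ltW.
- apply: continuous_subspaceT => t; apply: (@gtp_continuous _ (fun=> y) id).
    by move=> k; exact: cvg_cst.
  exact: cvg_id.
exists c; first by rewrite in_itv in c01.
apply/eqP; rewrite eq_le gtp_le_supnorm/=; apply: ge_sup.
  by exists `|gtp r y 0|, 0 => //=; rewrite in_itv/= lexx mulr_ge0// ltW.
by move=> _ [t ht <-]; rewrite ger0_norm ?gtp_ge0//; exact: cmax.
Qed.

Lemma supnorm_gt0 y : weak_nodes y -> 0 < supnorm (gtp r y).
Proof.
case=> y0 [yi yn]; have pi0 := pi_gt0 R.
have yr k : 0 <= y k <= 2 * pi.
  by rewrite -y0 yi//=; apply: le_trans yn; rewrite yi// -ltnS ltn_ord.
(* A point slightly to the right of 0 avoids the nodes at 0 as well as the positive ones. *)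
have near_neq k : \forall t \near 0^'+, t != y k.
  have := yr k => /andP[]; rewrite le_eqVlt => /predU1P[<- _|yk _].
    by apply: filterS (nbhs_right_gt 0) => t t0; rewrite gt_eqF.
  by apply: filterS (nbhs_right_lt yk) => t tk; rewrite lt_eqF.
have near_all := filter_forall _ near_neq.
have [t [[tne t0] t2]] : exists t, ((forall k, t != y k) /\ 0 < t) /\ t < 2 * pi.
  apply: (@filter_ex _ (0 : R)^'+); apply: filterI; last first.
    by apply: nbhs_right_lt; rewrite mulr_gt0.
  by apply: filterI; [exact: near_all|exact: nbhs_right_gt].
apply: lt_le_trans (gtp_le_supnorm y t).
rewrite gtpE ?expR_gt0// => k; apply: sin_neq0.
by have := yr k; have := tne k; rewrite neq_lt => /orP[] *; [right|left]; lra.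
Qed.

Lemma min_norm_le y : weak_nodes y -> min_norm r <= supnorm (gtp r y).
Proof.
move=> wy; apply: ge_inf; last by exists y.
by exists 0 => _ [w ww <-]; rewrite ltW// supnorm_gt0.
Qed.

Lemma weak_nodes_compact : compact [set v : 'rV[R]_n.+1 | weak_nodes (v ord0)].
Proof.
have cK : compact [set v : 'rV[R]_n.+1 | forall i, `[0, 2 * pi]%classic (v ord0 i)].
  by apply: (@rV_compact _ _ (fun=> `[0, 2 * pi]%classic)) => i; exact: segment_compact.
apply: (subclosed_compact _ cK); last first.
  move=> v [v0 [vi vn]] i /=; rewrite in_itv/= -v0 vi//=.
  by apply: le_trans vn; rewrite vi// -ltnS ltn_ord.
have cc i : continuous (fun v : 'rV[R]_n.+1 => v ord0 i) by exact: coord_continuous.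
have cle (i j : 'I_n.+1) : closed [set v : 'rV[R]_n.+1 | 0 <= v ord0 j - v ord0 i].
  apply: (@preimage_closed _ _ (fun v : 'rV[R]_n.+1 => v ord0 j - v ord0 i) [set x | 0 <= x]).
    by move=> v _; exact: (cvgB (@cc j v) (@cc i v)).
  exact: closed_ge.
rewrite (_ : mkset _ = [set v : 'rV[R]_n.+1 | v ord0 ord0 = 0] `&`
  ((\bigcap_(ij in [set ij : 'I_n.+1 * 'I_n.+1 | (ij.1 <= ij.2)%N])
     [set v : 'rV[R]_n.+1 | 0 <= v ord0 ij.2 - v ord0 ij.1])
   `&` [set v : 'rV[R]_n.+1 | v ord0 ord_max <= 2 * pi])).
  apply: closedI; [|apply: closedI].
  - apply: (@preimage_closed _ _ (fun v : 'rV[R]_n.+1 => v ord0 ord0) [set x | x = 0]).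
      by move=> v _; exact: cc.
    exact: closed_eq.
  - by apply: closed_bigI => ij _; exact: cle.
  - apply: (@preimage_closed _ _ (fun v : 'rV[R]_n.+1 => v ord0 ord_max) [set x | x <= 2 * pi]).
      by move=> v _; exact: cc.
    exact: closed_le.
apply/seteqP; split => v [v0 [vi vn]]; split=> //; split=> //.
  by move=> [i j] /= ij; rewrite subr_ge0; exact: vi.
by move=> i j ij; have /= := vi (i, j) ij; rewrite subr_ge0.
Qed.

(** Lower semicontinuity of the norm suffices: a value above [min_norm r] at a fixed [t] persists
    for nearby nodes. If no minimizer existed, compactness would give a uniform excess [e] over the
    infimum. *)
Lemma minimizer_exists : exists2 y, weak_nodes y & supnorm (gtp r y) = min_norm r.
Proof.
apply: contrapT => no.
have lt_norm y : weak_nodes y -> min_norm r < supnorm (gtp r y).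
  move=> wy; rewrite lt_neqAle min_norm_le// andbT; apply/eqP => E.
  by apply: no; exists y.
have /compact_near_coveringP cov := weak_nodes_compact.
have [e [e0 he]] : exists e : R, 0 < e /\
    [set v : 'rV[R]_n.+1 | weak_nodes (v ord0)] `<=`
    (fun v => min_norm r + e < supnorm (gtp r (v ord0))).
  apply: (@filter_ex _ (0 : R)^'+); apply: filterI; first exact: nbhs_right_gt.
  apply: (cov R (0 : R)^'+
    (fun e (v : 'rV[R]_n.+1) => min_norm r + e < supnorm (gtp r (v ord0))) _).
  move=> v wv; have [t _ tE] := supnorm_attained (v ord0).
  have := lt_norm _ wv; rewrite -tE => lt_t.
  pose d := (gtp r (v ord0) t - min_norm r) / 2.
  have d0 : 0 < d by rewrite /d; lra.
  have cg : {for v, continuous (fun u : 'rV[R]_n.+1 => gtp r (u ord0) t)}.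
    apply: (@gtp_continuous _ (fun u : 'rV[R]_n.+1 => u ord0) (fun=> t)).
      by move=> k; exact: coord_continuous.
    exact: cst_continuous.
  have nv : nbhs v [set u : 'rV[R]_n.+1 | min_norm r + d < gtp r (u ord0) t].
    by apply: (cvgr_gt _ cg); rewrite /d; lra.
  have ne : \forall e \near (0 : R)^'+, e < d by exact: nbhs_right_lt.
  exists ([set u : 'rV[R]_n.+1 | min_norm r + d < gtp r (u ord0) t], [set e | e < d]) => //=.
  move=> [u e] [/= hu hed]; have := gtp_le_supnorm (u ord0) t; lra.
have : min_norm r + e <= min_norm r.
  apply: lb_le_inf.
    exists (supnorm (gtp r (fun=> 0))), (fun=> 0) => //; split=> //.
    by split=> //; rewrite mulr_ge0// ltW// pi_gt0.
  move=> _ [y wy <-]; have Ey : (\row_i y i) ord0 = y.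
    by apply/funext => i; rewrite mxE.
  by have := he (\row_i y i); rewrite /mkset Ey => /(_ wy)/ltW.
lra.
Qed.

End Minimizer.

(** * Widening an arc that does not meet the norm *)

Section Widening.
Local Open Scope classical_set_scope.
Set Implicit Arguments. Unset Strict Implicit.
Variables (R : realType) (n : nat) (r : 'I_n.+1 -> R).
Hypothesis r_gt0 : forall j, 0 < r j.
Implicit Types (y w : 'I_n.+1 -> R) (a b : 'I_n.+1) (t h : R).

(* The displacements are balanced ([r a * (h / r a) = r b * (h / r b)]), as
   [logsin_spread] requires. *)
Definition widen y a b h (k : 'I_n.+1) : R :=
  y k + h * ((k == b)%:R / r b - (k == a)%:R / r a).

Lemma widen_l y a b h : a != b -> widen y a b h a = y a - h / r a.
Proof. by move=> /negbTE ab; rewrite /widen ab eqxx mul0r mul1r sub0r mulrN. Qed.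

Lemma widen_r y a b h : a != b -> widen y a b h b = y b + h / r b.
Proof.
by move=> /negbTE ab; rewrite /widen eq_sym ab eqxx mul0r mul1r subr0.
Qed.

Lemma widen_other y a b h k : k != a -> k != b -> widen y a b h k = y k.
Proof.
by move=> /negbTE ka /negbTE kb; rewrite /widen ka kb !mul0r subr0 mulr0 addr0.
Qed.

(* [B = y b + 2 * pi] is the case of an arc that wraps around the period. *)
Lemma widen_outside y a b (B M h t : R) : a != b -> 0 < h -> 0 < M ->
  B = y b \/ B = y b + 2 * pi -> y a <= B ->
  B + h / r b < t -> t < y a - h / r a + 2 * pi ->
  gtp r y t <= M -> gtp r (widen y a b h) t < M.
Proof.
move=> ab h0 M0 hB AB tB tA.
have ba : b != a by rewrite eq_sym.
have ha : 0 < h / r a by rewrite divr_gt0.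
have hb : 0 < h / r b by rewrite divr_gt0.
pose X := \prod_(k < n.+1 | (k != a) && (k != b)) (`|sin ((t - y k) / 2)| `^ r k).
have split w : (forall k, k != a -> k != b -> w k = y k) -> gtp r w t =
    X * (`|sin ((t - w a) / 2)| `^ r a * `|sin ((t - w b) / 2)| `^ r b).
  move=> hw; rewrite /gtp (bigD1 a)//= (bigD1 b)//= mulrA mulrC; congr (_ * _).
  by apply: eq_bigr => k /andP[ka kb]; rewrite hw.
(* Replacing [y b] by [B] puts the half angle between 0 and pi at the cost of at most a sign of the
   sine. *)
have shift (c : R) : `|sin ((t - (y b + c)) / 2)| = `|sin ((t - (B + c)) / 2)|.
  case: hB => ->//.
  rewrite (_ : (t - (y b + c)) / 2 = (t - (y b + 2 * pi + c)) / 2 + pi); last by field.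
  by rewrite sinDpi normrN.
rewrite (split y)// (split (widen y a b h)); last exact: widen_other.
rewrite widen_l// widen_r// shift -[in X in X <= _](addr0 (y b)) shift addr0.
have X0 : 0 <= X by apply: prodr_ge0 => k _; exact: powR_ge0.
rewrite !powR_sinE; try by apply: sin_neq0; left; lra.
rewrite -!expRD => hM.
(* If another node annihilates the product at [t], the strict bound comes from [0 < M]. *)
move: X0; rewrite le_eqVlt => /predU1P[<-|X0]; first by rewrite mul0r.
apply: lt_le_trans hM; rewrite ltr_pM2l// ltr_expR.
have := @logsin_spread R (r a) (r b) (h / r a / 2) (h / r b / 2) ((t - y a) / 2) ((t - B) / 2).
rewrite (_ : (t - y a) / 2 + h / r a / 2 = (t - (y a - h / r a)) / 2);
  last by field; rewrite gt_eqF.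
rewrite (_ : (t - B) / 2 - h / r b / 2 = (t - (B + h / r b)) / 2);
  last by field; rewrite gt_eqF.
apply=> //; try lra.
by field; rewrite !gt_eqF.
Qed.

(** Widening may move the first node away from 0; a rotation brings it back without changing the
    norm. *)
Lemma min_norm_le_cyclic y : (forall i j : 'I_n.+1, (i <= j)%N -> y i <= y j) ->
  y ord_max <= y ord0 + 2 * pi -> min_norm r <= supnorm (gtp r y).
Proof.
move=> yi yn; pose v k := y k - y ord0.
have wv : weak_nodes v.
  split; first by rewrite /v subrr.
  by split=> [i j /yi|]; rewrite /v; lra.
apply: le_trans (min_norm_le r_gt0 wv) _.
have [t _ <-] := supnorm_attained r_gt0 v.
have -> : gtp r v t = gtp r y (t + y ord0).
  by apply: eq_bigr => k _; congr (`|sin (_ / 2)| `^ _); rewrite /v; ring.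
exact: gtp_le_supnorm.
Qed.

(** Taking [a] first and [b] last among coinciding nodes keeps the order under a small widening; the
    last hypothesis keeps the total span at most [2 * pi]. For a degenerate arc the conclusion is
    absurd, which is how coincidences are excluded. *)
Lemma arc_meets_supnorm y a b (B : R) : weak_nodes y ->
  supnorm (gtp r y) = min_norm r -> a != b ->
  B = y b \/ B = y b + 2 * pi -> y a <= B ->
  (forall i : 'I_n.+1, (i < a)%N -> y i < y a) ->
  (forall j : 'I_n.+1, (b < j)%N -> y b < y j) ->
  y ord_max < 2 * pi \/ a != ord0 /\ b != ord_max ->
  exists2 t, y a < t < B & gtp r y t = supnorm (gtp r y).
Proof.
move=> wy ymin ab hB AB ya yb wrap.
set M := supnorm _.
have M0 : 0 < M by exact: supnorm_gt0.
have [y0 [yi yn]] := wy; have pi0 := pi_gt0 R.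
have [[t [/andP[At tB] Mt]]|no] := pselect (exists t, y a <= t <= B /\ M <= gtp r y t).
  have EM : gtp r y t = M by apply/eqP; rewrite eq_le Mt gtp_le_supnorm.
  have gB : gtp r y B = 0.
    by case: hB => ->; rewrite ?gtpD2pi gtp_eq0.
  exists t => //; rewrite !lt_neqAle At tB !andbT; apply/andP; split.
    by apply/eqP => E; move: M0; rewrite -EM -E gtp_eq0 ?ltxx.
  by apply/eqP => E; move: M0; rewrite -EM E gB ltxx.
exfalso.
have {}no t : y a <= t <= B -> gtp r y t < M.
  by move=> ht; rewrite ltNge; apply/negP => Mt; apply: no; exists t.
have w0 k : widen y a b 0 k = y k by rewrite /widen mul0r addr0.
have cw k : continuous (widen y a b ^~ k).
  move=> h; apply: cvgD; first exact: cvg_cst.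
  by apply: cvgM; [exact: cvg_id|exact: cvg_cst].
have order (i j : 'I_n.+1) : (i <= j)%N ->
    \forall h \near 0^'+, widen y a b h i <= widen y a b h j.
  move=> ij; have [->|ij'] := eqVneq i j; first exact: nearW.
  have {}ij : (i < j)%N by rewrite ltn_neqAle ij' ij.
  have [lt_y|le_y] := ltP (y i) (y j).
    apply: cvg_within; apply: filterS (_ : \forall h \near 0,
      0 < widen y a b h j - widen y a b h i).
      by move=> h; rewrite subr_gt0 => /ltW.
    by apply: (cvgr_gt _ (cvgB (@cw j 0) (@cw i 0))); rewrite !w0 subr_gt0.
  (* For coinciding nodes, [i] can only move to the left and [j] only to the right. *)
  have ja : j != a by apply/eqP => E; subst j; have := ya _ ij; rewrite ltNge le_y.
  have ib : i != b by apply/eqP => E; subst i; have := yb _ ij; rewrite ltNge le_y.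
  apply: filterS (nbhs_right_gt 0) => h h0.
  apply: le_trans (le_trans (yi _ _ (ltnW ij)) _).
    rewrite /widen (negbTE ib) mul0r sub0r gerDl mulrN oppr_le0.
    by rewrite mulr_ge0 ?(ltW h0)// divr_ge0 ?ler0n// ltW.
  rewrite /widen (negbTE ja) mul0r subr0 lerDl.
  by rewrite mulr_ge0 ?(ltW h0)// divr_ge0 ?ler0n// ltW.
have cyc : \forall h \near 0^'+, widen y a b h ord_max <= widen y a b h ord0 + 2 * pi.
  case: wrap => [yn'|[a0 bn]].
    apply: cvg_within; apply: filterS (_ : \forall h \near 0,
      widen y a b h ord_max - widen y a b h ord0 < 2 * pi).
      by move=> h; lra.
    by apply: (cvgr_lt _ (cvgB (@cw ord_max 0) (@cw ord0 0))); rewrite !w0 y0 subr0.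
  apply: filterS (nbhs_right_gt 0) => h h0.
  rewrite /widen (eq_sym ord_max b) (negbTE bn) (eq_sym ord0 a) (negbTE a0) !mul0r sub0r subr0 y0.
  rewrite mulrN.
  have : 0 <= h * ((ord_max == a)%:R / r a) by rewrite mulr_ge0 ?(ltW h0)// divr_ge0 ?ler0n// ltW.
  have : 0 <= h * ((ord0 == b)%:R / r b) by rewrite mulr_ge0 ?(ltW h0)// divr_ge0 ?ler0n// ltW.
  lra.
(* Parametrizing the widened arc by the fixed interval from 0 to 1 lets compactness give one bound
   on [h] valid for all [s]. *)
pose T h s := y a - h / r a + s * (B + h / r b - (y a - h / r a)).
have inside : \forall h \near 0^'+, forall s, 0 <= s <= 1 ->
    gtp r (widen y a b h) (T h s) < M.
  apply: cvg_within.
  have /compact_near_coveringP cov := @segment_compact R 0 1.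
  suff : \forall h \near (0 : R), `[0, 1] `<=` (fun s => gtp r (widen y a b h) (T h s) < M).
    by apply: filterS => h hs s s01; apply: hs; rewrite /= in_itv.
  apply: (cov R (nbhs (0 : R)) (fun h s => gtp r (widen y a b h) (T h s) < M) _).
  move=> s; rewrite /= in_itv/= => s01.
  have cg : {for (s, 0), continuous (fun p : R * R => gtp r (widen y a b p.2) (T p.2 p.1))}.
    have c1 : {for (s, 0), continuous (fun p : R * R => p.1)} by exact: cvg_fst.
    have c2 : {for (s, 0), continuous (fun p : R * R => p.2)} by exact: cvg_snd.
    apply: (@gtp_continuous _ _ _ r_gt0 _ (fun p : R * R => widen y a b p.2)).
      by move=> k; apply: (@continuous_comp _ _ _ (fun p : R * R => p.2) (widen y a b ^~ k));
        [exact: c2|exact: cw].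
    have c3 (c : R) : {for (s, 0), continuous (fun p : R * R => p.2 / c)}.
      by apply: cvgM; [exact: c2|exact: cvg_cst].
    have c4 : {for (s, 0), continuous (fun p : R * R => y a - p.2 / r a)}.
      by apply: cvgB; [exact: cvg_cst|exact: c3].
    apply: cvgD; first exact: c4.
    apply: cvgM; first exact: c1.
    by apply: cvgB; [apply: cvgD; [exact: cvg_cst|exact: c3]|exact: c4].
  apply: (cvgr_lt _ cg); rewrite /T /= !mul0r subr0 addr0.
  have -> : widen y a b 0 = y by apply/funext => k; exact: w0.
  by apply: no; nra.
have order' : \forall h \near 0^'+, forall i j : 'I_n.+1, (i <= j)%N ->
    widen y a b h i <= widen y a b h j.
  have H (p : 'I_n.+1 * 'I_n.+1) : \forall h \near 0^'+,
      (p.1 <= p.2)%N -> widen y a b h p.1 <= widen y a b h p.2.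
    have [le_p|lt_p] := leqP p.1 p.2; last by exact: nearW.
    by apply: filterS (order _ _ le_p).
  by apply: filterS (filter_forall _ H) => h hp i j; exact: (hp (i, j)).
have [h [[h0 h1] [h2 h3]]] : exists h, (0 < h /\
    (forall i j : 'I_n.+1, (i <= j)%N -> widen y a b h i <= widen y a b h j)) /\
   (widen y a b h ord_max <= widen y a b h ord0 + 2 * pi /\
    forall s, 0 <= s <= 1 -> gtp r (widen y a b h) (T h s) < M).
  apply: (@filter_ex _ (0 : R)^'+); apply: filterI; apply: filterI.
  - exact: nbhs_right_gt.
  - exact: order'.
  - exact: cyc.
  - exact: inside.
have ha : 0 < h / r a by rewrite divr_gt0.
have hb : 0 < h / r b by rewrite divr_gt0.
have := min_norm_le_cyclic h1 h2; rewrite -ymin -/M leNgt => /negP; apply.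
have [t0 _ <-] := supnorm_attained r_gt0 (widen y a b h).
(* In the period starting at the left end of the widened arc, a maximum point lies either on that
   arc or in the range of [widen_outside]; both give a norm below [M]. *)
have [t /andP[At tA] <-] := gtp_reduce r (widen y a b h) (y a - h / r a) t0.
have [tB|Bt] := leP t (B + h / r b); last first.
  by apply: (@widen_outside y a b B) => //; exact: gtp_le_supnorm.
pose s := (t - (y a - h / r a)) / (B + h / r b - (y a - h / r a)).
have d0 : 0 < B + h / r b - (y a - h / r a) by lra.
have -> : t = T h s by rewrite /T /s divfK ?gt_eqF// addrC subrK.
apply: h3; rewrite /s ler_pdivlMr// ler_pdivrMr//; lra.
Qed.

End Widening.

(** * Minimizers have distinct nodes and equioscillate *)

Section Equioscillation.
Set Implicit Arguments. Unset Strict Implicit.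
Variables (R : realType) (n : nat) (r : 'I_n.+1 -> R).
Hypothesis r_gt0 : forall j, 0 < r j.
Implicit Types (y w : 'I_n.+1 -> R).

Lemma first_index y (i : 'I_n.+1) : (forall i j : 'I_n.+1, (i <= j)%N -> y i <= y j) ->
  exists a : 'I_n.+1, [/\ (a <= i)%N, y a = y i
    & forall j : 'I_n.+1, (j < a)%N -> y j < y a].
Proof.
move=> yi; case: (@arg_minnP _ i (fun k => y k == y i) val) => // a /eqP ya amin.
exists a; split=> //; first by apply: amin.
move=> j ja; rewrite lt_neqAle yi ?(ltnW ja)// andbT ya.
by apply: contraL ja => /amin; rewrite -leqNgt.
Qed.

Lemma last_index y (i : 'I_n.+1) : (forall i j : 'I_n.+1, (i <= j)%N -> y i <= y j) ->
  exists b : 'I_n.+1, [/\ (i <= b)%N, y b = y i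
    & forall j : 'I_n.+1, (b < j)%N -> y b < y j].
Proof.
move=> yi; case: (@arg_maxnP _ i (fun k => y k == y i) val) => // b /eqP yb bmax.
exists b; split=> //; first by apply: bmax.
move=> j bj; rewrite lt_neqAle yi ?(ltnW bj)// andbT yb eq_sym.
by apply: contraL bj => /bmax; rewrite -leqNgt.
Qed.

Lemma minimizer_strict y : weak_nodes y -> supnorm (gtp r y) = min_norm r ->
  strict_nodes y.
Proof.
move=> wy ymin; have [y0 [yi yn]] := wy; have pi0 := pi_gt0 R.
(* A last node at [2 * pi] would coincide modulo the period with the node 0. Excluding this first
   supplies the span condition for the other coincidences. *)
have yn' : y ord_max < 2 * pi.
  rewrite lt_neqAle yn andbT; apply/eqP => yE.
  have [a [_ ya amin]] := first_index ord_max yi.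
  have [b [_ yb bmax]] := last_index ord0 yi.
  have a0 : a != ord0 by apply/eqP => E; move: ya; rewrite E y0 yE; lra.
  have bn : b != ord_max by apply/eqP => E; move: yb; rewrite E y0 yE; lra.
  have ab : a != b by apply/eqP => E; move: yb; rewrite -E ya y0 yE; lra.
  have [|||t] := @arc_meets_supnorm R n r r_gt0 y a b (y b + 2 * pi) wy ymin ab _ _ amin bmax.
  - by right.
  - by rewrite ya yE yb y0 add0r.
  - by right.
  - by rewrite ya yE yb y0 add0r => /andP[/lt_trans h /h]; rewrite ltxx.
split=> //; split=> // i j ij.
rewrite lt_neqAle yi ?(ltnW ij)// andbT; apply/eqP => yE.
have [a [ai ya amin]] := first_index i yi.
have [b [jb yb bmax]] := last_index j yi.
have ab : a != b.
  by apply/eqP => E; have := leq_ltn_trans ai (leq_trans ij jb); rewrite E ltnn.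
have [|||t] := @arc_meets_supnorm R n r r_gt0 y a b (y b) wy ymin ab _ _ amin bmax.
- by left.
- by rewrite ya yb yE.
- by left.
- by rewrite ya yb yE => /andP[/lt_trans h /h]; rewrite ltxx.
Qed.

Lemma minimizer_equioscillates y : weak_nodes y -> supnorm (gtp r y) = min_norm r ->
  exists z : 'I_n.+1 -> R, interlace y z /\ forall j, gtp r y (z j) = supnorm (gtp r y).
Proof.
move=> wy ymin; have [y0 [ylt yn]] := minimizer_strict wy ymin.
have [_ [yi _]] := wy; have pi0 := pi_gt0 R.
have M0 := supnorm_gt0 r_gt0 wy.
pose nxt (j : 'I_n.+1) : R := if (j < n)%N then y (inord j.+1) else 2 * pi.
have arc j : exists t, y j < t < nxt j /\ gtp r y t = supnorm (gtp r y).
  rewrite /nxt; case: ifPn => [jn|].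
    have vj : (inord j.+1 : 'I_n.+1) = j.+1 :> nat by rewrite inordK.
    have jj : (j < (inord j.+1 : 'I_n.+1))%N by rewrite vj.
    have [|||||t ht tE] :=
      @arc_meets_supnorm R n r r_gt0 y j (inord j.+1) _ wy ymin _ (or_introl erefl).
    - by apply/eqP => E; move: jj; rewrite -E ltnn.
    - by apply: yi; exact: ltnW.
    - by move=> i; exact: ylt.
    - by move=> i; exact: ylt.
    - by left.
    - by exists t.
  rewrite -leqNgt => nj.
  have {nj} -> : j = ord_max by apply/val_inj/eqP; rewrite eqn_leq nj -ltnS ltn_ord.
  (* With a single node the two ends of the arc are the same node and cannot be moved apart; here
     any maximum point works, since the polynomial vanishes at 0 and [2 * pi]. *)
  have [n0|n0] := posnP n.
    have g0 := gtp_eq0 r_gt0 y ord0; rewrite y0 in g0.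
    have [t ht tE] := supnorm_attained r_gt0 y; exists t; split=> //.
    have -> : ord_max = ord0 :> 'I_n.+1 by apply/val_inj.
    rewrite y0 !lt_neqAle; case/andP: ht => -> ->; rewrite !andbT; apply/andP; split.
      by apply/eqP => E; move: M0; rewrite -tE -E g0 ltxx.
    by apply/eqP => E; move: M0; rewrite -tE E -[2 * pi]add0r gtpD2pi g0 ltxx.
  have [|||||t ht tE] :=
      @arc_meets_supnorm R n r r_gt0 y ord_max ord0 _ wy ymin _ (or_intror erefl).
  - by apply/eqP => /(congr1 val)/= E; rewrite E in n0.
  - by rewrite y0 add0r ltW.
  - by move=> i; exact: ylt.
  - by move=> i; exact: ylt.
  - by left.
  - by exists t; rewrite y0 add0r in ht.
have [z hz] := choice arc; exists z; split; last by move=> j; have [] := hz j.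
have nxt_le (j i : 'I_n.+1) : (j < i)%N -> nxt j <= y i.
  move=> ji; have jn : (j < n)%N by apply: leq_trans ji _; rewrite -ltnS ltn_ord.
  by rewrite /nxt jn; apply: yi; rewrite inordK.
have nxt_le2pi j : nxt j <= 2 * pi.
  rewrite /nxt; case: ifP => // _; apply: le_trans (ltW yn).
  by apply: yi; rewrite -ltnS ltn_ord.
split=> [i j ij|]; first by have [/andP[+ _] _] := hz j; apply: le_lt_trans; exact: yi.
split=> [i j ji|j]; have [/andP[_ zj] _] := hz j.
  by apply: lt_le_trans zj _; exact: nxt_le.
by apply: lt_le_trans zj _.
Qed.

End Equioscillation.

(** * Uniqueness and characterization of the extremal nodes *)

Lemma strict_weak_nodes (R : realType) (n : nat) (w : 'I_n.+1 -> R) :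
  strict_nodes w -> weak_nodes w.
Proof.
case=> w0 [wi wn]; split=> //; split; last exact: ltW.
move=> i j; rewrite leq_eqVlt => /predU1P[/val_inj ->//|/wi/ltW//].
Qed.

Theorem theorem13p3 (R : realType) (n : nat) (r : 'I_n.+1 -> R)
  (hr : forall j, 0 < r j) :
  (exists! w : 'I_n.+1 -> R,
     strict_nodes w /\ supnorm (gtp r w) = min_norm r)
  /\ (forall w : 'I_n.+1 -> R, strict_nodes w ->
       (supnorm (gtp r w) = min_norm r <->
        exists z : 'I_n.+1 -> R, interlace w z /\
          forall j, gtp r w (z j) = supnorm (gtp r w))).
Proof.
have [y wy ymin] := minimizer_exists hr.
have sy := minimizer_strict hr wy ymin.
have [z [iyz zE]] := minimizer_equioscillates hr wy ymin.
(* Every equioscillating system is the fixed minimizer [y]: its norm is at least [min_norm r], which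
   is the comparison of maxima that rigidity asks for. *)
have equi (w : 'I_n.+1 -> R) : strict_nodes w ->
    (exists z : 'I_n.+1 -> R, interlace w z /\
       forall j, gtp r w (z j) = supnorm (gtp r w)) -> w = y.
  move=> sw [zeta [iwz zetaE]].
  apply: (interlacing_rigidity hr sy iyz _ sw iwz).
    move=> j; apply: stationary_at_max.
      by move=> k; exact: interlace_sin_neq0.
    by move=> t; rewrite zE; exact: gtp_le_supnorm.
  by move=> j; rewrite zE zetaE ymin min_norm_le//; exact: strict_weak_nodes.
split.
  exists y; split=> // w [sw wmin]; apply/esym/equi => //.
  exact: minimizer_equioscillates (strict_weak_nodes sw) wmin.
move=> w sw; split=> [wmin|/equi ->//].
exact: minimizer_equioscillates (strict_weak_nodes sw) wmin.
Qed.
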